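(* Let $p,q,l,m$ be positive integers with $q$ odd. Then $$\mathrm{Ehr}_{T^{(l+1)}_q\star S^{(m+1)}_p}(z)=\frac{1+m\,z+l\,z^{\frac{q+1}{2}}+m\,l\,z^{\frac{q+3}{2}}}{(1-z)^{p+q+2}}.$$ In particular, for $q\ge 3$ and $l<m$ this shows that the inequalities $\mathrm{a}_i(P)\ge \mathrm{a}_1(P)$ for $1\le i\le\deg(P)-1$ are, in general, false for lattice polytopes without interior lattice points: $P=T^{(l+1)}_q\star S^{(m+1)}_p$ has no interior lattice points, and there is an $i$ with $1\le i\le \deg(P)-1$ and $\mathrm{a}_i(P)<\mathrm{a}_1(P)$.
   Context: For a $d$-dimensional convex lattice polytope $P\subset\mathbb{R}^d$ (vertices in $\mathbb{Z}^d$, $\dim P=d$), let $\mathrm{G}_P(k)=\#(kP\cap\mathbb{Z}^d)$ (so $\mathrm{G}_P(0)=1$). The Ehrhart series of $P$ is the formal power series $\mathrm{Ehr}_P(z)=\sum_{k\ge0}\mathrm{G}_P(k)z^k$; it can be written as $\mathrm{Ehr}_P(z)=\frac{\mathrm{a}_0(P)+\mathrm{a}_1(P)z+\cdots+\mathrm{a}_d(P)z^d}{(1-z)^{d+1}}$, which defines the $\mathrm{a}_i(P)$. $\deg(P)$ is the degree of the polynomial in the numerator. For a positive integer $m$ and $d\ge 1$, with $e_i$ the $i$-th unit vector of $\mathbb{R}^d$ (and $e_0:=0$) and $o$ the origin, $T^{(m)}_d=\mathrm{conv}\{o,e_1,e_1+e_2,e_2+e_3,\dots,e_{d-2}+e_{d-1},e_{d-1}+m\,e_d\}$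 (for $d=1$: $\mathrm{conv}\{o,m\,e_1\}$) and $S^{(m)}_d=\mathrm{conv}\{o,e_1,e_2,\dots,e_{d-1},m\,e_d\}$; these are $d$-dimensional lattice simplices. For lattice polytopes $P\subset\mathbb{R}^p$ and $Q\subset\mathbb{R}^q$ of dimensions $p$ and $q$, their join is the $(p+q+1)$-dimensional lattice polytope $P\star Q=\mathrm{conv}\{(x,0_q,0),(0_p,y,1):x\in P,\ y\in Q\}\subset\mathbb{R}^{p+q+1}$, where $0_p,0_q$ are the zero vectors of dimension $p$ and $q$. *)

(* Defs.v *)
From mathcomp Require Import all_boot all_order all_algebra archimedean finmap.
From mathcomp Require Import all_classical reals convex topology normedtype.

Set Implicit Arguments.
Unset Strict Implicit.
Unset Printing Implicit Defensive.

Import Order.TTheory GRing.Theory Num.Theory.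
Import numFieldNormedType.Exports.
Local Open Scope classical_set_scope.
Local Open Scope ring_scope.

Definition convex_hull (R : realType) (V : lmodType R) (A : set V) : set V :=
  smallest (@convex_set R V) A.

Definition lattice (R : realType) (d : nat) : set 'rV[R]_d :=
  [set x | forall j, x ord0 j \is a Num.int].
Arguments lattice R d : clear implicits.

(* The span of the differences of the points of V is the linear space parallel
   to the affine hull of P, so the last condition says dim P = d. *)
Definition lattice_polytope (R : realType) (d : nat) (P : set 'rV[R]_d) :=
  exists V : seq 'rV[R]_d,
    [/\ V != [::], [set` V] `<=` lattice R d, P = convex_hull [set` V] &
        \dim <<[seq v - w | v <- V, w <- V]>>%VS = d].

Definition dilate (R : realType) (d : nat) (k : nat) (P : set 'rV[R]_d) :
  set 'rV[R]_d := [set k%:R *: x | x in P].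

(* [fset_set] sends an infinite set to [fset0]; the sets counted here are
   finite whenever P is bounded. *)
Definition ehrhart_count (R : realType) (d : nat) (P : set 'rV[R]_d) (k : nat) :
  nat := #|` fset_set (dilate k P `&` lattice R d) |.

(* A formal power series over the integers is its sequence of coefficients. *)
Definition series_mul (f g : nat -> int) : nat -> int :=
  fun n => \sum_(i < n.+1) f i * g (n - i)%N.

Definition series_of_poly (h : {poly int}) : nat -> int := fun n => h`_n.

(* f = h / g in the ring of formal power series; meant for g with constant
   term 1, which is then invertible. *)
Definition series_eq_frac (f : nat -> int) (h g : {poly int}) : Prop :=
  series_mul f (series_of_poly g) = series_of_poly h.

Definition Ehr (R : realType) (d : nat) (P : set 'rV[R]_d) : nat -> int :=
  fun k => (ehrhart_count P k)%:Z.

(* The polynomial a_0(P) + a_1(P) z + ... + a_d(P) z^d; it is unique, and it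
   exists by Ehrhart's theorem when P is a d-dimensional lattice polytope. *)
Definition ehrhart_numerator (R : realType) (d : nat) (P : set 'rV[R]_d) :
  {poly int} :=
  xget 0 [set h : {poly int} |
    (size h <= d.+1)%N /\ series_eq_frac (Ehr P) h ((1 - 'X) ^+ d.+1)].

Definition ehrhart_coef (R : realType) (d : nat) (P : set 'rV[R]_d) (i : nat) :
  int := (ehrhart_numerator P)`_i.

Definition ehrhart_deg (R : realType) (d : nat) (P : set 'rV[R]_d) : nat :=
  (size (ehrhart_numerator P)).-1.

Definition no_interior_lattice_point (R : realType) (d : nat)
    (P : set 'rV[R]_d) : Prop :=
  P° `&` lattice R d = set0.

(* Unit vectors are numbered from 1, so that evec R d 0 = 0. *)
Definition evec (R : realType) (d i : nat) : 'rV[R]_d :=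
  \row_(j < d) (j.+1 == i)%:R.

Definition Tsimplex (R : realType) (m d : nat) : set 'rV[R]_d :=
  convex_hull ([set 0]
    `|` [set evec R d i.-1 + evec R d i | i in [set i | (1 <= i < d)%N]]
    `|` [set evec R d d.-1 + m%:R *: evec R d d]).
Arguments Tsimplex R m d : clear implicits.

Definition Ssimplex (R : realType) (m d : nat) : set 'rV[R]_d :=
  convex_hull ([set 0]
    `|` [set evec R d i | i in [set i | (1 <= i < d)%N]]
    `|` [set m%:R *: evec R d d]).
Arguments Ssimplex R m d : clear implicits.

Definition polytope_join (R : realType) (p q : nat) (P : set 'rV[R]_p)
    (Q : set 'rV[R]_q) : set 'rV[R]_(p + q + 1) :=
  convex_hull ([set row_mx (row_mx x 0) 0 | x in P]
    `|` [set row_mx (row_mx 0 y) (const_mx 1) | y in Q]).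

(* Main.v *)
Require Import Defs.
From mathcomp Require Import all_boot all_order all_algebra archimedean finmap.
From mathcomp Require Import all_classical reals convex topology normedtype.
From mathcomp Require Import interval_inference.
From mathcomp Require Import zify ring lra.

Import Order.TTheory GRing.Theory Num.Theory.
Import numFieldNormedType.Exports.
Local Open Scope classical_set_scope.
Local Open Scope ring_scope.

(** Both simplices have very few lattice points in the half-open parallelepiped
spanned by their vertices placed at height one, and everything follows from an
explicit list of these points.

Let v be the vertices of a lattice simplex.  A point of its k-th dilate is a
combination of the v_i with nonnegative coefficients of sum k.  Splitting each
coefficient into its fractional and integer parts writes every lattice point of
the k-th dilate uniquely as a box point, with coefficients in [0, 1) and an
integral sum h called its height, plus a combination of the v_i with natural
coefficients of sum k - h.  Hence the Ehrhart series is the sum of the z^h over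
all box points divided by (1 - z)^(number of vertices): this is [Ehr_box], for
families subject to [box_decomposition].

The join of two simplices is the simplex on the union of the two vertex
families, and its last coordinate forces both partial sums of coefficients to
be integers.  So the box points of the join are the pairs of box points, with
added heights ([box_decomposition_join]), and the numerators multiply.

For the simplex S with last vertex M e_d, the last coefficient is j/M and all
the other coordinates force integrality, except that the coefficient of the
origin completes the sum: M - 1 box points of height 1 besides the origin
([Ssimplex_box]).  For T in odd dimension d, consecutive coefficients have
integral sum, so modulo 1 they alternate between j/M and -j/M; each of the
(d + 1)/2 consecutive pairs contributes 1 to the height when j <> 0
([Tsimplex_box]).  The product of the two numerators is
(1 + l z^((q+1)/2)) (1 + m z).

The join lies between the hyperplanes where the last coordinate is 0 or 1, so
its interior contains no lattice point.  For q >= 3 the coefficient l of index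
(q + 1)/2 lies below the degree (q + 3)/2, and l < m is the failing
inequality. *)

(** * Convex hulls of finite families and joins *)

(** Binary convexity with unnormalized weights, the form in which weights add up
along an induction. *)
Lemma convex_set_combination {R : realType} {V : lmodType R} (A : set V)
    (a b : R) (x y : V) :
  convex_set (A : set (convex_lmodType V)) -> 0 <= a -> 0 <= b -> 0 < a + b ->
  A x -> A y -> A ((a + b)^-1 *: (a *: x + b *: y)).
Proof.
move=> cA a0 b0 ab0 Ax Ay.
have t0 : 0 <= a / (a + b) by rewrite divr_ge0 // ltW.
have t1 : a / (a + b) <= 1 by rewrite ler_pdivrMr // mul1r lerDl.
have := cA x y (Itv01 t0 t1); rewrite !inE => /(_ Ax Ay).
congr (A _); rewrite /conv /= scalerDr !scalerA; congr (_ *: _ + _ *: _).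
  by rewrite mulrC.
by rewrite /Itv.num_sem /= /unstable.onem; field; rewrite gt_eqF.
Qed.

Lemma convex_hull_convex {R : realType} {V : lmodType R} (A : set V) :
  convex_set (convex_hull A : set (convex_lmodType V)).
Proof.
move=> x y t; rewrite !inE => hx hy B [cB AB].
by have := cB x y t; rewrite !inE; apply; [exact: hx|exact: hy].
Qed.

Lemma convex_hull_range {R : realType} {V : lmodType R} {I : finType}
    (v : I -> V) :
  convex_hull (range v) = [set x | exists c : I -> R,
    [/\ forall i, 0 <= c i, \sum_i c i = 1 & x = \sum_i c i *: v i]].
Proof.
apply/seteqP; split.
  apply: smallest_sub => [x y t|_ [i _ <-]]; last first.
    exists (fun k => (k == i)%:R); split=> [k||]; first exact: ler0n.
      rewrite (bigD1 i) //= eqxx big1 ?addr0 // => k /negPf -> //.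
    rewrite (bigD1 i) //= eqxx scale1r big1 ?addr0 // => k /negPf ->.
    by rewrite scale0r.
  rewrite !inE => -[c [c0 c1 ->]] [c' [c'0 c'1 ->]].
  have t0 : 0 <= t%:num by [].
  have t1 : 0 <= 1 - t%:num by rewrite subr_ge0.
  exists (fun i => t%:num * c i + (1 - t%:num) * c' i); split=> [i||].
  - by rewrite addr_ge0 // mulr_ge0.
  - by rewrite big_split /= -!mulr_sumr c1 c'1 !mulr1 addrC subrK.
  - rewrite /conv /= !scaler_sumr -big_split /=; apply: eq_bigr => i _.
    by rewrite [in RHS]scalerDl !scalerA.
move=> x [c [c0 c1 ->]] A [cA {}/(_ (v _) (imageT v _)) vA].
(* A partial sum of weights may vanish, so the invariant carries a point y of A
   that absorbs the terms already summed, with their total weight s. *)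
suff step (r : seq I) (s : R) (y : V) : 0 <= s -> A y ->
    0 < s + \sum_(i <- r) c i ->
    A ((s + \sum_(i <- r) c i)^-1 *: (s *: y + \sum_(i <- r) c i *: v i)).
  have [i0 _|I0] := pickP (@predT I).
    have := step (index_enum I) 0 (v i0) (lexx 0) (vA i0).
    rewrite scale0r !add0r c1 invr1 scale1r; exact.
  by move: c1; rewrite big_pred0 // => /esym/eqP; rewrite oner_eq0.
elim: r s y => [|i r IH] s y s0 Ay.
  rewrite !big_nil !addr0 => s_gt0.
  by rewrite scalerA mulVf ?scale1r // gt_eqF.
rewrite !big_cons !addrA => pos.
have Avi := vA i.
have [sc|sc] := eqVneq (s + c i) 0.
  have/andP[/eqP s00 /eqP ci0] : (s == 0) && (c i == 0).
    by rewrite -paddr_eq0 // sc.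
  have := IH 0 y (lexx 0) Ay; rewrite s00 ci0 !scale0r !add0r; apply.
  by move: pos; rewrite s00 ci0 !add0r.
have sc0 : 0 < s + c i by rewrite lt_def sc addr_ge0.
have Ay' := convex_set_combination _ _ _ _ _ cA s0 (c0 i) sc0 Ay Avi.
have := IH (s + c i) _ (ltW sc0) Ay' pos.
by rewrite scalerA divff ?gt_eqF // scale1r.
Qed.

Definition join_vertex {R : realType} {d1 d2 : nat} {I1 I2 : finType}
    (v1 : I1 -> 'rV[R]_d1) (v2 : I2 -> 'rV[R]_d2) (i : I1 + I2) :
    'rV[R]_(d1 + d2 + 1) :=
  match i with
  | inl i1 => row_mx (row_mx (v1 i1) 0) 0
  | inr i2 => row_mx (row_mx 0 (v2 i2)) (const_mx 1)
  end.

Lemma sum_row_mx {R : realType} {d1 d2 : nat} {I : finType}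
    (f : I -> 'rV[R]_d1) (g : I -> 'rV[R]_d2) :
  \sum_i row_mx (f i) (g i) = row_mx (\sum_i f i) (\sum_i g i).
Proof.
apply/rowP=> j; rewrite summxE.
by case: (split_ordP j) => k ->; rewrite ?row_mxEl ?row_mxEr summxE;
  apply: eq_bigr => i _; rewrite ?row_mxEl ?row_mxEr.
Qed.

Lemma sum_join_vertex {R : realType} {d1 d2 : nat} {I1 I2 : finType}
    (v1 : I1 -> 'rV[R]_d1) (v2 : I2 -> 'rV[R]_d2) (c : I1 + I2 -> R) :
  \sum_i c i *: join_vertex v1 v2 i =
  row_mx (row_mx (\sum_i c (inl i) *: v1 i) (\sum_i c (inr i) *: v2 i))
    (const_mx (\sum_i c (inr i))).
Proof.
rewrite big_sumType /=.
under eq_bigr do rewrite !scale_row_mx !scaler0.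
under [X in _ + X]eq_bigr do rewrite !scale_row_mx !scaler0.
rewrite !sum_row_mx !add_row_mx !sumr_const !mul0rn !addr0 !add0r.
congr row_mx; apply/rowP=> j; rewrite summxE mxE.
by apply: eq_bigr => i _; rewrite !mxE mulr1.
Qed.

Lemma polytope_join_hull {R : realType} {d1 d2 : nat} {I1 I2 : finType}
    (v1 : I1 -> 'rV[R]_d1) (v2 : I2 -> 'rV[R]_d2) :
  polytope_join (convex_hull (range v1)) (convex_hull (range v2)) =
  convex_hull (range (join_vertex v1 v2)).
Proof.
apply/seteqP; split; apply: smallest_sub; try exact: convex_hull_convex.
  rewrite !convex_hull_range => _ [[_ [c [c0 c1 ->]] <-]|[_ [c [c0 c1 ->]] <-]].
    exists (fun i => if i is inl k then c k else 0).
    split=> [[k|k]||] //; first by rewrite big_sumType /= c1 big1 ?addr0.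
    rewrite sum_join_vertex /=; congr (row_mx (row_mx _ _) _).
      by rewrite big1 // => i _; rewrite scale0r.
    by apply/rowP=> j; rewrite !mxE big1.
  exists (fun i => if i is inr k then c k else 0).
  split=> [[k|k]||] //; first by rewrite big_sumType /= c1 big1 ?add0r.
  rewrite sum_join_vertex /= c1; congr (row_mx (row_mx _ _) _).
  by rewrite big1 // => i _; rewrite scale0r.
move=> _ [[i|i] _ <-]; apply: sub_gen_smallest.
  by left; exists (v1 i) => //; apply: sub_gen_smallest; exists i.
by right; exists (v2 i) => //; apply: sub_gen_smallest; exists i.
Qed.

(** * Box points and the Ehrhart series *)

(** The points [\sum_i frac j i *: v i], for j in J, are the box points of the
simplex with vertices v, and [h j] is the height of the j-th one.  The last
field says that the coefficients giving lattice points are exactly the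
integer translates of the box coefficients. *)
Record box_decomposition {R : realType} {d : nat} {I J : finType}
    (v : I -> 'rV[R]_d) (frac : J -> I -> R) (h : J -> nat) : Prop :=
  BoxDecomposition {
    box_free : forall c : I -> R,
      \sum_i c i *: v i = 0 -> \sum_i c i = 0 -> forall i, c i = 0;
    box_frac : forall j i, 0 <= frac j i < 1;
    box_inj : forall j j', frac j =1 frac j' -> j = j';
    box_height : forall j, \sum_i frac j i = (h j)%:R;
    box_lattice : forall c : I -> R,
      (lattice R d (\sum_i c i *: v i) /\ \sum_i c i \is a Num.int) <->
      exists j, forall i, c i - frac j i \is a Num.int }.

Definition join_frac {R : realType} {I1 I2 J1 J2 : finType}
    (f1 : J1 -> I1 -> R) (f2 : J2 -> I2 -> R) (j : J1 * J2) (i : I1 + I2) : R :=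
  match i with inl i1 => f1 j.1 i1 | inr i2 => f2 j.2 i2 end.

Lemma lattice_row_mx {R : realType} {d1 d2 : nat} (x : 'rV[R]_d1)
    (y : 'rV[R]_d2) :
  lattice R (d1 + d2) (row_mx x y) <-> lattice R d1 x /\ lattice R d2 y.
Proof.
split=> [xyP|[xP yP] j].
  split=> j; first by have := xyP (lshift d2 j); rewrite row_mxEl.
  by have := xyP (rshift d1 j); rewrite row_mxEr.
by case: (split_ordP j) => k ->; rewrite ?row_mxEl ?row_mxEr.
Qed.

(** The last coordinate of the join reads off the total weight of the second
family, so a lattice combination with integral total weight is a pair of such
combinations, one for each factor. *)
Lemma box_decomposition_join {R : realType} {d1 d2 : nat}
    {I1 I2 J1 J2 : finType} {v1 : I1 -> 'rV[R]_d1} {v2 : I2 -> 'rV[R]_d2}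
    {f1 : J1 -> I1 -> R} {f2 : J2 -> I2 -> R} {h1 : J1 -> nat}
    {h2 : J2 -> nat} :
  box_decomposition v1 f1 h1 -> box_decomposition v2 f2 h2 ->
  box_decomposition (join_vertex v1 v2) (join_frac f1 f2)
    (fun j => (h1 j.1 + h2 j.2)%N).
Proof.
move=> B1 B2; split.
- move=> c; rewrite sum_join_vertex big_sumType /= => e s.
  have [e1 e2] : row_mx (\sum_i c (inl i) *: v1 i) (\sum_i c (inr i) *: v2 i)
      = 0 /\ const_mx (\sum_i c (inr i)) = 0 :> 'rV[R]_1.
    by apply: eq_row_mx; rewrite e row_mx0.
  have [e3 e4] : \sum_i c (inl i) *: v1 i = 0 /\ \sum_i c (inr i) *: v2 i = 0.
    by apply: eq_row_mx; rewrite e1 row_mx0.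
  have s2 : \sum_i c (inr i) = 0 by have := congr1 (fun x : 'rV_1 => x 0 0) e2; rewrite !mxE.
  have s1 : \sum_i c (inl i) = 0 by move: s; rewrite s2 addr0.
  by case=> i; [apply: (box_free _ _ _ B1 _ e3 s1)|apply: (box_free _ _ _ B2 _ e4 s2)].
- by move=> [j1 j2] [i|i] /=; [apply: (box_frac _ _ _ B1)|apply: (box_frac _ _ _ B2)].
- move=> [j1 j2] [k1 k2] e; congr pair.
    by apply: (box_inj _ _ _ B1) => i; have := e (inl i).
  by apply: (box_inj _ _ _ B2) => i; have := e (inr i).
- move=> [j1 j2]; rewrite big_sumType /= natrD.
  by rewrite (box_height _ _ _ B1) (box_height _ _ _ B2).
- move=> c; rewrite sum_join_vertex big_sumType /=.
  have L1 := box_lattice _ _ _ B1 (fun i => c (inl i)).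
  have L2 := box_lattice _ _ _ B2 (fun i => c (inr i)).
  split.
    move=> [/lattice_row_mx[/lattice_row_mx[xP yP] tP] sP].
    have t2 : \sum_i c (inr i) \is a Num.int by have := tP 0; rewrite mxE.
    have t1 : \sum_i c (inl i) \is a Num.int.
      by rewrite -[X in X \is a _](addrK (\sum_i c (inr i))) rpredB.
    have [j1 h1P] := (L1.1 (conj xP t1)).
    have [j2 h2P] := (L2.1 (conj yP t2)).
    by exists (j1, j2) => -[i|i].
  move=> [[j1 j2] jP].
  have [xP t1] := L1.2 (ex_intro _ j1 (fun i => jP (inl i))).
  have [yP t2] := L2.2 (ex_intro _ j2 (fun i => jP (inr i))).
  split; last exact: rpredD.
  by apply/lattice_row_mx; split; [exact/lattice_row_mx|move=> j; rewrite mxE].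
Qed.

Lemma int_gtN1_natr {R : realType} (x : R) :
  x \is a Num.int -> -1 < x -> exists n : nat, x = n%:R.
Proof.
move=> /intrP[[n|n] ->]; first by exists n.
by rewrite NegzE mulrNz ltrN2 ltrn1 ltnS.
Qed.

(** Uniqueness of the decomposition into a box point and natural coefficients
comes from affine independence of the vertices together with uniqueness of
fractional parts.  The bound K on the natural coefficients is decoupled from k
so that all the counts up to K live in one finite type. *)
Lemma ehrhart_count_box {R : realType} {d : nat} {I J : finType}
    {v : I -> 'rV[R]_d} {frac : J -> I -> R} {h : J -> nat} (K k : nat) :
  box_decomposition v frac h -> (0 < #|I|)%N -> (k <= K)%N ->
  ehrhart_count (convex_hull (range v)) k =
  #|[set ja : J * {ffun I -> 'I_K.+1} | (h ja.1 + \sum_i ja.2 i == k)%N]%SET|.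
Proof.
move=> B /card_gt0P[i0 _] kK.
set S := finset _.
pose c (ja : J * {ffun I -> 'I_K.+1}) i : R := frac ja.1 i + (ja.2 i)%:R.
pose f ja := \sum_i c ja i *: v i.
have sum_c ja : \sum_i c ja i = (h ja.1 + \sum_i ja.2 i)%:R.
  by rewrite big_split /= (box_height _ _ _ B) natrD natr_sum.
rewrite /ehrhart_count; suff -> : dilate k (convex_hull (range v)) `&` lattice R d =
    [set` [fset f ja | ja in S]%fset].
  rewrite set_fsetK card_in_imfset /=; first by rewrite cardE.
  move=> a b; rewrite !inE => /eqP aS /eqP bS eq_f.
  have cE i : c a i = c b i.
    apply/eqP; rewrite -subr_eq0; apply/eqP; move: i.
    apply: (box_free _ _ _ B); last by rewrite sumrB !sum_c aS bS subrr.
    by under eq_bigr do rewrite scalerBl; rewrite sumrB -/(f a) eq_f subrr.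
  have aE i : a.2 i = b.2 i.
    have := cE i; rewrite /c.
    have /andP[] := box_frac _ _ _ B a.1 i; have /andP[] := box_frac _ _ _ B b.1 i.
    move=> ? ? ? ? e; apply/val_inj/eqP; rewrite eqn_leq.
    by apply/andP; split; rewrite -ltnS -(ltr_nat R) -natr1; lra.
  have a1 : a.1 = b.1.
    by apply: (box_inj _ _ _ B) => i; have := cE i; rewrite /c aE => /addIr.
  have a2 : a.2 = b.2 by apply/ffunP.
  by move: a b a1 a2 {aS bS eq_f cE aE} => [? ?] [? ?] /= -> ->.
apply/seteqP; split; last first.
  move=> y /imfsetP[/= ja]; rewrite inE => /eqP jaS ->.
  have fP : lattice R d (f ja).
    apply: (proj1 (_ : _ /\ \sum_i c ja i \is a Num.int)).
    apply/(box_lattice _ _ _ B); exists ja.1 => i.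
    by rewrite /c addrC addKr natr_int.
  split=> //; rewrite convex_hull_range.
  have c0 i : 0 <= c ja i.
    by rewrite addr_ge0 //; case/andP: (box_frac _ _ _ B ja.1 i).
  (* The zeroth dilate is the image of any point of the hull under scaling by 0,
     so here a vertex serves as the preimage. *)
  have [k0|k0] := eqVneq k 0%N.
    have cz i : c ja i = 0.
      apply/eqP; have /psumr_eq0P -> // : \sum_i c ja i = 0.
      by rewrite sum_c jaS k0.
    exists (v i0).
      exists (fun i => (i == i0)%:R); split=> [i||]; first exact: ler0n.
        by rewrite (bigD1 i0) //= eqxx big1 ?addr0 // => i /negPf ->.
      rewrite (bigD1 i0) //= eqxx scale1r big1 ?addr0 // => i /negPf ->.
      by rewrite scale0r.
    by rewrite k0 scale0r /f big1 // => i _; rewrite cz scale0r.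
  have k0' : k%:R != 0 :> R by rewrite pnatr_eq0.
  exists (k%:R^-1 *: f ja); last by rewrite scalerA divff ?scale1r.
  exists (fun i => k%:R^-1 * c ja i); split=> [i||].
  - by rewrite mulr_ge0 // invr_ge0 ler0n.
  - by rewrite -mulr_sumr sum_c jaS mulVf.
  - by rewrite scaler_sumr; apply: eq_bigr => i _; rewrite scalerA.
move=> _ [[x + <-] kxP]; rewrite convex_hull_range => -[b [b0 b1 xE]].
have kxE : k%:R *: x = \sum_i (k%:R * b i) *: v i.
  by rewrite xE scaler_sumr; apply: eq_bigr => i _; rewrite scalerA.
have kbE : \sum_i k%:R * b i = k%:R by rewrite -mulr_sumr b1 mulr1.
have [j jP] : exists j, forall i, k%:R * b i - frac j i \is a Num.int.
  by apply/(box_lattice _ _ _ B); rewrite -kxE kbE natr_int.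
(* A fractional part is less than 1, so these integers exceed -1. *)
have aP i : exists n : nat, k%:R * b i - frac j i = n%:R.
  apply: int_gtN1_natr => //; have /andP[_] := box_frac _ _ _ B j i.
  have : 0 <= k%:R * b i by rewrite mulr_ge0.
  lra.
have [a aE] := choice aP.
have ha : (h j + \sum_i a i)%N = k.
  apply/eqP; rewrite -(eqr_nat R) natrD natr_sum -(box_height _ _ _ B) -big_split /=.
  by rewrite -[eqbRHS]kbE; apply/eqP/eq_bigr => i _; rewrite -aE addrC subrK.
have aK i : (a i < K.+1)%N.
  rewrite ltnS (leq_trans _ kK) // -ha (bigD1 i) //=; lia.
have caE i : c (j, [ffun i => Ordinal (aK i)]) i = k%:R * b i.
  by rewrite /c ffunE /= -aE addrC subrK.
apply/imfsetP; exists (j, [ffun i => Ordinal (aK i)]) => /=.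
  rewrite inE /= -[X in _ == X]ha; apply/eqP; congr addn.
  by apply: eq_bigr => i _; rewrite ffunE.
by rewrite kxE; apply: eq_bigr => i _; rewrite caE.
Qed.

(** Up to order N the Ehrhart series agrees with the polynomial
(\sum_j X^(h j)) (1 + X + ... + X^N)^n, where n is the number of vertices, and
multiplication by (1 - X)^n turns the second factor into (1 - X^(N+1))^n, which
is 1 modulo X^(N+1). *)
Lemma Ehr_box {R : realType} {d : nat} {I J : finType}
    {v : I -> 'rV[R]_d} {frac : J -> I -> R} {h : J -> nat} :
  box_decomposition v frac h -> (0 < #|I|)%N ->
  series_eq_frac (Ehr (convex_hull (range v))) (\sum_j 'X^(h j))
    ((1 - 'X) ^+ #|I|).
Proof.
move=> B I0; apply/funext => N; rewrite /series_mul /series_of_poly.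
pose G : {poly int} := \sum_(i < N.+1) 'X^i.
pose H : {poly int} := \sum_j 'X^(h j).
have countE k : (k <= N)%N -> Ehr (convex_hull (range v)) k = (H * G ^+ #|I|)`_k.
  move=> kN; rewrite /Ehr (ehrhart_count_box _ _ B I0 kN).
  rewrite -prodr_const bigA_distr_bigA big_distrlr pair_big /= coef_sum.
  rewrite -sum1_card raddf_sum /= big_mkcond /=; apply: eq_bigr => -[j a] _.
  rewrite inE /= prodrXr -exprD coefXn eq_sym.
  by case: ifP.
under eq_bigr => i _ do rewrite (countE _ (ltn_ord i)).
rewrite -coefM -mulrA -exprMn.
have -> : G * (1 - 'X) = 1 - 'X^(N.+1).
  rewrite mulrC -opprB mulNr.
  rewrite -subrX1 opprB //.
have [Q ->] : exists Q, (1 - 'X^(N.+1) : {poly int}) ^+ #|I| = 1 + 'X^(N.+1) * Q.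
  elim: #|I| => [|n [Q IH]]; first by exists 0; rewrite mulr0 addr0.
  by exists (Q - 1 - 'X^(N.+1) * Q); rewrite exprS IH; ring.
by rewrite mulrDr mulr1 coefD mulrCA coefXnM ltnSn addr0.
Qed.

(** The numerator is determined by the series, being its product with the
denominator. *)
Lemma ehrhart_numerator_eq {R : realType} {d : nat} (P : set 'rV[R]_d)
    (h : {poly int}) :
  (size h <= d.+1)%N -> series_eq_frac (Ehr P) h ((1 - 'X) ^+ d.+1) ->
  ehrhart_numerator P = h.
Proof.
move=> sh hP; apply: xget_unique => // g [_ gP].
by apply/polyP => i; have := congr1 (fun f => f i) (etrans (esym gP) hP).
Qed.

(** * Full dimension and interior lattice points *)

(** The zero combination is a lattice point, so some box point has integral
coefficients, and the coefficients of a vertex are integer translates of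
these. *)
Lemma box_vertex_lattice {R : realType} {d : nat} {I J : finType}
    {v : I -> 'rV[R]_d} {frac : J -> I -> R} {h : J -> nat} (i : I) :
  box_decomposition v frac h -> lattice R d (v i).
Proof.
move=> B.
have [j jP] : exists j, forall k, 0 - frac j k \is a Num.int.
  apply/(box_lattice _ _ _ B (fun=> 0)); split; last by rewrite big1.
  by move=> k; rewrite big1 ?mxE // => k' _; rewrite scale0r.
have -> : v i = \sum_k (k == i)%:R *: v k.
  rewrite (bigD1 i) //= eqxx scale1r big1 ?addr0 // => k /negPf ->.
  by rewrite scale0r.
apply: (proj1 (_ : _ /\ \sum_k (k == i)%:R \is a Num.int)).
apply/(box_lattice _ _ _ B); exists j => k.
by rewrite rpredD ?natr_int //; have := jP k; rewrite sub0r.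
Qed.

(** The differences with one fixed vertex are d linearly independent vectors. *)
Lemma span_differences {R : realType} {d : nat} {I : finType}
    (v : I -> 'rV[R]_d) :
  (forall c : I -> R,
    \sum_i c i *: v i = 0 -> \sum_i c i = 0 -> forall i, c i = 0) ->
  #|I| = d.+1 ->
  \dim <<[seq x - y | x <- map v (enum I), y <- map v (enum I)]>>%VS = d.
Proof.
move=> vfree cI.
pose e (o : 'I_d.+1) : I := enum_val (cast_ord (esym cI) o).
have e_bij : bijective e.
  exists (fun i => cast_ord cI (enum_rank i)) => i.
    by rewrite /e enum_valK cast_ordKV.
  by rewrite /e cast_ordK enum_rankK.
pose u o := v (e (lift ord0 o)) - v (e ord0).
pose X : d.-tuple 'rV[R]_d := [tuple u o | o < d].
have freeX : free X.
  apply/freeP => k kX.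
  case: e_bij => e' eK e'K.
  pose k' o := if unlift ord0 o is Some j then k j else - \sum_j k j.
  have k'0 : k' ord0 = - \sum_j k j by rewrite /k' unlift_none.
  have k'S j : k' (lift ord0 j) = k j by rewrite /k' liftK.
  have cz : forall i, k' (e' i) = 0.
    apply: vfree.
      rewrite (reindex e) /=; last by exists e' => i _; rewrite ?eK ?e'K.
      under eq_bigr do rewrite eK.
      rewrite big_ord_recl k'0; under [X in _ + X]eq_bigr do rewrite k'S.
      rewrite scaleNr scaler_suml addrC -sumrB -[RHS]kX; apply: eq_bigr => i _.
      by rewrite -tnth_nth tnth_mktuple scalerBr.
    rewrite (reindex e) /=; last by exists e' => i _; rewrite ?eK ?e'K.
    under eq_bigr do rewrite eK.
    by rewrite big_ord_recl k'0; under [X in _ + X]eq_bigr do rewrite k'S; rewrite addNr.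
  by move=> i; rewrite -k'S -[lift _ _]eK cz.
apply/eqP; rewrite eqn_leq; apply/andP; split.
  rewrite (leq_trans (dimvS (subvf _))) // dimvf dim_matrix.
  by have -> : (1 * d)%R = d by exact: mul1n.
have := freeX; rewrite /free size_tuple => /eqP {1}<-.
apply: dimvS; apply: sub_span => x /mapP[o _ ->].
by apply: allpairs_f; apply: map_f; rewrite mem_enum.
Qed.

Lemma lattice_polytope_box {R : realType} {d : nat} {I J : finType}
    {v : I -> 'rV[R]_d} {frac : J -> I -> R} {h : J -> nat} :
  box_decomposition v frac h -> #|I| = d.+1 ->
  lattice_polytope (convex_hull (range v)).
Proof.
move=> B cI.
have vE : [set` map v (enum I)] = range v.
  apply/seteqP; split=> [x /mapP[i _ ->]|_ [i _ <-]]; first by exists i.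
  by apply/mapP; exists i; rewrite ?mem_enum.
exists (map v (enum I)); rewrite vE; split=> //.
- by rewrite -size_eq0 size_map -cardE cI.
- by move=> _ [i _ <-]; apply: box_vertex_lattice B.
- exact: span_differences (box_free _ _ _ B) cI.
Qed.

(** The last coordinate of a point of the join lies in [0, 1], hence strictly
between 0 and 1 at an interior point, where it cannot be an integer. *)
Lemma join_no_interior_lattice_point {R : realType} {d1 d2 : nat}
    (P : set 'rV[R]_d1) (Q : set 'rV[R]_d2) :
  no_interior_lattice_point (polytope_join P Q).
Proof.
pose e : 'I_(d1 + d2 + 1) := rshift (d1 + d2) ord0.
have slab : polytope_join P Q `<=` [set x | 0 <= x 0 e <= 1].
  apply: smallest_sub => [x y t|x].
    rewrite !inE /= => /andP[x0 x1] /andP[y0 y1].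
    have t0 : 0 <= t%:num by [].
    have t1 : t%:num <= 1 by [].
    rewrite /conv /= !mxE /unstable.onem; apply/andP; split; nra.
  by move=> [[y _ <-]|[y _ <-]] /=; rewrite row_mxEr !mxE ?lexx ?ler01.
apply/seteqP; split=> // x [xint xlat].
have /nbhs_ballP[r /= r0 rP] : nbhs x (polytope_join P Q) := xint.
have step (s : R) : `|s| < r -> 0 <= x 0 e + s <= 1.
  move=> sr.
  have : ball x r (\row_j (x 0 j + (if j == e then s else 0))).
    split=> // i j; rewrite mxE (ord1 i) -ball_normE /=.
    by rewrite opprD addrA subrr sub0r normrN; case: ifP => _; rewrite ?normr0.
  by move/rP/slab; rewrite /= mxE eqxx.
have r2 : `|r / 2| < r by rewrite ger0_norm; lra.
have /andP[_ h1] := step _ r2.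
have /andP[h2 _] := step (- (r / 2)) (ltac:(by rewrite normrN)).
have /intrP[z xz] := xlat e.
move: h1 h2; rewrite xz => h1 h2.
have z0 : 0 < z by rewrite -(ltr0z R); lra.
have z1 : z < 1 by rewrite -(ltrz1 R); lra.
by move: z0 z1; lia.
Qed.

(** * Residues modulo 1 *)

(** Coefficients that agree modulo 1 away from the first index, and whose sums are
integers, also agree modulo 1 at the first index. *)
Lemma sum_congr_int_ord0 {R : realType} {d : nat} (c f : 'I_d.+1 -> R) :
  \sum_i c i \is a Num.int -> \sum_i f i \is a Num.int ->
  (forall i : 'I_d, c (lift ord0 i) - f (lift ord0 i) \is a Num.int) ->
  forall i, c i - f i \is a Num.int.
Proof.
move=> cint fint cf i; case: (unliftP ord0 i) => [k|] -> //.
have -> : c ord0 - f ord0 = \sum_i c i - \sum_i f i -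
    \sum_i (c (lift ord0 i) - f (lift ord0 i)).
  by rewrite !(@big_ord_recl _ _ _ d) sumrB; ring.
by rewrite !rpredB // rpred_sum.
Qed.

(** The representative in [0, m) of j or of -j modulo m, according to the sign b. *)
Definition residue (m j : nat) (b : bool) : nat :=
  if b then j else ((m - j) %% m)%N.

Lemma ltn_residue {m : nat} (j : 'I_m) (b : bool) : (residue m j b < m)%N.
Proof. by case: b => //=; rewrite ltn_pmod // (leq_trans _ (ltn_ord j)). Qed.

Lemma residueD {m : nat} (j : 'I_m) :
  (residue m j true + residue m j false = (0 < j) * m)%N.
Proof.
case: m j => [[]//|m] j /=; case: posnP => [->|j0]; first by rewrite subn0 modnn.
have jm := ltn_ord j; rewrite modn_small; lia.
Qed.

Definition residue_frac (R : realType) (m : nat) (j : 'I_m) (b : bool) : R :=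
  (residue m j b)%:R / m%:R.

Lemma residue_frac_itv {R : realType} {m : nat} (j : 'I_m) (b : bool) :
  0 <= residue_frac R m j b < 1.
Proof.
have m0 : (0 < m)%N by rewrite (leq_trans _ (ltn_ord j)).
rewrite divr_ge0 // ltr_pdivrMr ?ltr0n // mul1r ltr_nat.
exact: ltn_residue.
Qed.

Lemma residue_frac_inj {R : realType} {m : nat} (j k : 'I_m) :
  residue_frac R m j true = residue_frac R m k true -> j = k.
Proof.
have m0 : (0 < m)%N by rewrite (leq_trans _ (ltn_ord j)).
move=> /(mulIf _) e; apply/val_inj/eqP; rewrite -(eqr_nat R); apply/eqP/e.
by rewrite invr_eq0 pnatr_eq0 -lt0n.
Qed.

Lemma residue_fracD {R : realType} {m : nat} (j : 'I_m) :
  residue_frac R m j true + residue_frac R m j false = (0 < j)%:R.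
Proof.
have m0 : (0 < m)%N by rewrite (leq_trans _ (ltn_ord j)).
rewrite -mulrDl -natrD residueD natrM mulfK //.
by rewrite pnatr_eq0 -lt0n.
Qed.

(** The last coordinate of a lattice point is m times the last coefficient x, so
x is a multiple of 1/m and falls into one of m classes modulo 1. *)
Lemma residue_frac_int {R : realType} {m : nat} (x : R) :
  (0 < m)%N -> m%:R * x \is a Num.int ->
  exists j : 'I_m, x - residue_frac R m j true \is a Num.int.
Proof.
move=> m0 /intrP[z xz].
have mz : m%:Z != 0 by rewrite eqz_nat -lt0n.
have mR : m%:R != 0 :> R by rewrite pnatr_eq0 -lt0n.
have rlt : (`|(z %% m)%Z| < m)%N.
  by rewrite -ltz_nat gez0_abs ?modz_ge0 // ltz_pmod // ltz_nat.
exists (Ordinal rlt); apply/intrP; exists (z %/ m)%Z.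
apply: (mulfI mR); rewrite mulrBr xz /residue_frac /=.
rewrite mulrCA divff // mulr1 {1}(divz_eq z m) pmulrn gez0_abs ?modz_ge0 //.
by rewrite intrD intrM addrK mulrC.
Qed.

Lemma residue_frac_mul {R : realType} {m : nat} (j : 'I_m) :
  m%:R * residue_frac R m j true = j%:R.
Proof.
have m0 : (0 < m)%N by rewrite (leq_trans _ (ltn_ord j)).
by rewrite mulrCA divff ?mulr1 // pnatr_eq0 -lt0n.
Qed.

(** * Vertices and coordinates of the simplices T and S *)

Lemma evec0 (R : realType) (d : nat) : evec R d 0 = 0.
Proof. by apply/rowP => j; rewrite !mxE. Qed.

Lemma sum_evec {R : realType} {d : nat} (a : nat -> R) (j : 'I_d) :
  (\sum_(i < d.+1) a i *: evec R d i) 0 j = a j.+1.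
Proof.
rewrite summxE (bigD1 (lift ord0 j)) //= !mxE eqxx mulr1 big1 ?addr0 // => i ij.
rewrite !mxE; case: eqVneq => [ji|_]; last by rewrite mulr0.
by case/eqP: ij; apply/val_inj; rewrite /= /bump /= add1n.
Qed.

Lemma sum_evec_pred {R : realType} {d : nat} (a : nat -> R) (j : 'I_d) :
  (\sum_(i < d.+1) a i *: evec R d i.-1) 0 j =
  if (j.+1 < d)%N then a j.+2 else 0.
Proof.
rewrite summxE; case: ltnP => jd.
  rewrite (bigD1 (inord j.+2)) //= !mxE inordK //= eqxx mulr1.
  rewrite big1 ?addr0 // => i ij; rewrite !mxE; case: eqVneq => [ji|_].
    case/eqP: ij; apply/val_inj; rewrite /= inordK //.
    by case: (val i) ji => //= n ->.
  by rewrite mulr0.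
rewrite big1 // => i _; rewrite !mxE; case: eqVneq => [ji|_]; last by rewrite mulr0.
by have := ltn_ord i; lia.
Qed.

Definition last_weight (R : realType) (m d i : nat) : R :=
  if i == d then m%:R else 1.

(** The formula covers all vertices at once: for i = 0 both unit vectors vanish,
and the weight m occurs only at i = d. *)
Definition Tvertex (R : realType) (m d : nat) (i : 'I_d.+1) : 'rV[R]_d :=
  evec R d i.-1 + last_weight R m d i *: evec R d i.

Definition Svertex (R : realType) (m d : nat) (i : 'I_d.+1) : 'rV[R]_d :=
  last_weight R m d i *: evec R d i.

Lemma TsimplexE (R : realType) (m d : nat) :
  (0 < d)%N -> Tsimplex R m d = convex_hull (range (Tvertex R m d)).
Proof.
move=> d0; congr convex_hull; apply/seteqP; split.
  move=> x [[->|[i /= /andP[i0 id] <-]]|->].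
  - exists ord0 => //; rewrite /Tvertex /last_weight /= evec0 scaler0 addr0 //.
  - exists (inord i) => //; rewrite /Tvertex /last_weight inordK; last by lia.
    by rewrite ltn_eqF // scale1r.
  - by exists ord_max => //; rewrite /Tvertex /last_weight eqxx.
move=> _ [i _ <-]; rewrite /Tvertex /last_weight.
have := ltn_ord i; case: eqVneq => [->|id] ilt; first by right.
left; have [->|i0] := posnP i; first by left; rewrite evec0 scaler0 addr0.
by right; exists i; rewrite /= ?scale1r //; lia.
Qed.

Lemma SsimplexE (R : realType) (m d : nat) :
  (0 < d)%N -> Ssimplex R m d = convex_hull (range (Svertex R m d)).
Proof.
move=> d0; congr convex_hull; apply/seteqP; split.
  move=> x [[->|[i /= /andP[i0 id] <-]]|->].
  - by exists ord0 => //; rewrite /Svertex evec0 scaler0.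
  - exists (inord i) => //; rewrite /Svertex /last_weight inordK; last by lia.
    by rewrite ltn_eqF // scale1r.
  - by exists ord_max => //; rewrite /Svertex /last_weight eqxx.
move=> _ [i _ <-]; rewrite /Svertex /last_weight.
have := ltn_ord i; case: eqVneq => [->|id] ilt; first by right.
left; have [->|i0] := posnP i; first by left; rewrite evec0 scaler0.
by right; exists i; rewrite /= ?scale1r //; lia.
Qed.

Lemma sum_Svertex {R : realType} {m d : nat} (a : nat -> R) (j : 'I_d) :
  (\sum_(i < d.+1) a i *: Svertex R m d i) 0 j =
  last_weight R m d j.+1 * a j.+1.
Proof.
rewrite mulrC -(sum_evec (fun i => a i * last_weight R m d i)).
by congr (fun_of_matrix _ _ _); apply: eq_bigr => i _; rewrite scalerA.
Qed.

Lemma sum_Tvertex {R : realType} {m d : nat} (a : nat -> R) (j : 'I_d) :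
  (\sum_(i < d.+1) a i *: Tvertex R m d i) 0 j =
  if (j.+1 < d)%N then a j.+1 + a j.+2 else m%:R * a d.
Proof.
under eq_bigr do rewrite scalerDr.
rewrite big_split /= mxE sum_evec_pred sum_Svertex /last_weight.
case: (ltnP j.+1 d) => jd; first by rewrite ltn_eqF // mul1r addrC.
have -> : j.+1 = d by apply/eqP; rewrite eqn_leq ltn_ord jd.
by rewrite eqxx add0r.
Qed.

(** * Box points of T *)

(** Used with S the integers for the lattice condition, and with S = {0} for
affine independence. *)
Lemma alternating_congr {R : pzRingType} (S : {pred R}) (a : nat -> R)
    (d : nat) :
  zmod_closed S -> (forall n, (0 < n < d)%N -> a n + a n.+1 \in S) ->
  forall n, (0 < n <= d)%N -> a n - (-1) ^+ (d - n) * a d \in S.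
Proof.
move=> [S0 SB] aS n /andP[n0 nd].
rewrite -{1}(subKn nd); have : (d - n < d)%N by lia.
elim: (d - n)%N => [|k IH] kd; first by rewrite subn0 expr0 mul1r subrr.
have -> : a (d - k.+1)%N - (-1) ^+ k.+1 * a d =
    (a (d - k.+1)%N + a (d - k.+1).+1) - (a (d - k)%N - (-1) ^+ k * a d).
  have -> : ((d - k.+1).+1 = d - k)%N by lia.
  by rewrite exprS mulN1r mulNr opprK opprB addrACA subrr addr0.
by apply: SB; [apply: aS; lia|apply: IH; lia].
Qed.

Definition Tfrac (R : realType) (m d : nat) (j : 'I_m) (i : 'I_d.+1) : R :=
  residue_frac R m j (odd i).

Lemma sum_Tfrac {R : realType} {m d : nat} (j : 'I_m) :
  odd d -> \sum_i Tfrac R m d j i = (d.+1./2 * (0 < j))%:R.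
Proof.
move=> d_odd; have : d.+1 = (d.+1./2).*2 by rewrite -[LHS]odd_double_half /= d_odd.
rewrite /Tfrac; move: d.+1 (_./2) => n s ->{n d d_odd}.
elim: s => [|s IH]; first by rewrite big_ord0.
rewrite doubleS !big_ord_recr /= IH odd_double -addrA [X in _ + X]addrC /=.
by rewrite residue_fracD -natrD mulSn addnC.
Qed.

Lemma Tsimplex_box {R : realType} {m d : nat} :
  (0 < m)%N -> odd d ->
  box_decomposition (Tvertex R m d) (Tfrac R m d)
    (fun j => d.+1./2 * (0 < j))%N.
Proof.
move=> m0 d_odd.
have d0 : (0 < d)%N by case: d d_odd.
have mR : m%:R != 0 :> R by rewrite pnatr_eq0 -lt0n.
have ordl : (d.-1 < d)%N by rewrite prednK.
split.
- move=> c cv0 cs0.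
  pose a n := c (inord n).
  have cE i : c i = a i by rewrite /a inord_val.
  have coord (j : 'I_d) : (\sum_(i < d.+1) a i *: Tvertex R m d i) 0 j = 0.
    by under eq_bigr do rewrite -cE; rewrite cv0 mxE.
  have ad : a d = 0.
    have := coord (Ordinal ordl); rewrite sum_Tvertex /= prednK // ltnn.
    by move/eqP; rewrite mulf_eq0 (negPf mR) => /eqP.
  have an n : (0 < n <= d)%N -> a n = 0.
    move=> nd; apply/eqP.
    have := @alternating_congr R (pred1 0) a d _ _ n nd.
    rewrite ad mulr0 subr0; apply.
      by split=> [|x y]; rewrite !inE // => /eqP -> /eqP ->; rewrite subrr.
    move=> k kd; have jlt : (k.-1 < d)%N by lia.
    have := coord (Ordinal jlt); rewrite sum_Tvertex /= prednK; last by lia.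
    by case: ltnP => [_ ->|]; [rewrite inE|lia].
  move=> i; case: (posnP i) => [i0|i0]; last by rewrite cE an // i0 -ltnS ltn_ord.
  have -> : i = ord0 by apply/val_inj.
  move: cs0; rewrite big_ord_recl big1 ?addr0 // => k _.
  by rewrite cE an //= /bump /= add1n ltn_ord.
- by move=> j i; apply: residue_frac_itv.
- move=> j k /(_ ord_max); rewrite /Tfrac /= d_odd.
  exact: residue_frac_inj.
- by move=> j; apply: sum_Tfrac.
- move=> c.
  pose a n := c (inord n).
  have cE i : c i = a i by rewrite /a inord_val.
  have cvE : \sum_i c i *: Tvertex R m d i = \sum_(i < d.+1) a i *: Tvertex R m d i.
    by apply: eq_bigr => i _; rewrite cE.
  have fD (j : 'I_m) n : residue_frac R m j (odd n) + residue_frac R m j (odd n.+1) \is a Num.int.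
    by rewrite /=; case: (odd n) => /=; last rewrite addrC; rewrite residue_fracD natr_int.
  rewrite cvE; split=> [[cv cs]|[j cf]].
    have [j jP] : exists j : 'I_m, a d - residue_frac R m j true \is a Num.int.
      apply: residue_frac_int => //.
      by have := cv (Ordinal ordl); rewrite sum_Tvertex /= prednK // ltnn.
    exists j; apply: sum_congr_int_ord0 => //; first by rewrite sum_Tfrac ?natr_int.
    move=> i; rewrite cE /Tfrac /= /bump /= add1n.
    have : a i.+1 - (-1) ^+ (d - i.+1) * a d \is a Num.int.
      apply: (@alternating_congr R Num.int a d); last exact: ltn_ord.
        by split=> [|x y xi yi]; [exact: rpred0|exact: rpredB].
      move=> n nd; have jlt : (n.-1 < d)%N by lia.
      have := cv (Ordinal jlt); rewrite sum_Tvertex /= prednK; last by lia.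
      by case: ltnP => //; lia.
    rewrite -signr_odd oddB ?ltn_ord // d_odd /= negbK.
    case: (odd i) => /=.
      rewrite expr1 mulN1r opprK => ai.
      have -> : a i.+1 - residue_frac R m j false = (a i.+1 + a d) -
          (a d - residue_frac R m j true) -
          (residue_frac R m j true + residue_frac R m j false) by ring.
      by rewrite residue_fracD; apply: rpredB; [exact: rpredB|exact: natr_int].
    rewrite expr0 mul1r => ai.
    have -> : a i.+1 - residue_frac R m j true =
       (a i.+1 - a d) + (a d - residue_frac R m j true) by ring.
    exact: rpredD.
  have af n : (n <= d)%N -> a n - residue_frac R m j (odd n) \is a Num.int.
    by move=> nd; have := cf (inord n); rewrite /Tfrac inordK.
  split=> [k|].
    rewrite sum_Tvertex; case: ltnP => kd.
      have -> : a k.+1 + a k.+2 =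
          (a k.+1 - residue_frac R m j (odd k.+1)) +
          (a k.+2 - residue_frac R m j (odd k.+2)) +
          (residue_frac R m j (odd k.+1) + residue_frac R m j (odd k.+2)) by ring.
      by apply: rpredD; [apply: rpredD; apply: af => //; exact: ltnW|exact: fD].
    have -> : m%:R * a d = m%:R * (a d - residue_frac R m j (odd d)) +
       m%:R * residue_frac R m j (odd d) by ring.
    apply: rpredD; last by rewrite d_odd residue_frac_mul natr_int.
    by apply: rpredM; [exact: natr_int|exact: af].
  have -> : \sum_i c i = \sum_i (c i - Tfrac R m d j i) + \sum_i Tfrac R m d j i.
    by rewrite sumrB subrK.
  by rewrite sum_Tfrac // rpredD ?natr_int // rpred_sum.
Qed.

(** * Box points of S *)

Definition Sfrac (R : realType) (m d : nat) (j : 'I_m) (i : 'I_d.+1) : R :=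
  if i == 0%N :> nat then residue_frac R m j false
  else if i == d :> nat then residue_frac R m j true else 0.

Lemma sum_Sfrac {R : realType} {m d : nat} (j : 'I_m) :
  (0 < d)%N -> \sum_i Sfrac R m d j i = (0 < j)%:R.
Proof.
case: d => // d _; rewrite big_ord_recl big_ord_recr /= big1 => [|i _].
  by rewrite add0r /Sfrac /= eqxx addrC residue_fracD.
by rewrite /Sfrac /= /bump /= add1n eqSS ltn_eqF.
Qed.

Lemma Ssimplex_box {R : realType} {m d : nat} :
  (0 < m)%N -> (0 < d)%N ->
  box_decomposition (Svertex R m d) (Sfrac R m d) (fun j => (0 < j)%N : nat).
Proof.
move=> m0 d0.
have mR : m%:R != 0 :> R by rewrite pnatr_eq0 -lt0n.
split.
- move=> c cv0 cs0.
  pose a n := c (inord n).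
  have cE i : c i = a i by rewrite /a inord_val.
  have an (k : 'I_d) : a k.+1 = 0.
    have : (\sum_(i < d.+1) a i *: Svertex R m d i) 0 k = 0.
      by under eq_bigr do rewrite -cE; rewrite cv0 mxE.
    rewrite sum_Svertex => /eqP; rewrite mulf_eq0 /last_weight => /orP[|/eqP//].
    by case: ifP; rewrite ?(negPf mR) ?oner_eq0.
  move=> i; case: (unliftP ord0 i) => [k|] ->; first by rewrite cE; apply: an.
  move: cs0; rewrite big_ord_recl big1 ?addr0 // => k _.
  by rewrite cE; apply: an.
- move=> j i; rewrite /Sfrac; case: eqP => _; first exact: residue_frac_itv.
  by case: eqP => _; [exact: residue_frac_itv|rewrite lexx ltr01].
- move=> j k /(_ ord_max); rewrite /Sfrac /= gtn_eqF // eqxx.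
  exact: residue_frac_inj.
- by move=> j; apply: sum_Sfrac.
- move=> c.
  pose a n := c (inord n).
  have cE i : c i = a i by rewrite /a inord_val.
  have cvE : \sum_i c i *: Svertex R m d i = \sum_(i < d.+1) a i *: Svertex R m d i.
    by apply: eq_bigr => i _; rewrite cE.
  rewrite cvE; split=> [[cv cs]|[j cf]].
    have ordl : (d.-1 < d)%N by rewrite prednK.
    have [j jP] : exists j : 'I_m, a d - residue_frac R m j true \is a Num.int.
      apply: residue_frac_int => //.
      have := cv (Ordinal ordl); rewrite sum_Svertex /= prednK //.
      by rewrite /last_weight eqxx.
    exists j; apply: sum_congr_int_ord0 => //; first by rewrite sum_Sfrac ?natr_int.
    move=> i; rewrite cE /Sfrac /= /bump /= add1n.
    have := cv i; rewrite sum_Svertex /last_weight.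
    by case: eqVneq => [->//|_]; rewrite mul1r subr0.
  split=> [k|].
    have := cf (inord k.+1); rewrite sum_Svertex /Sfrac /last_weight -/(a k.+1).
    rewrite inordK ?ltnS //=; case: eqVneq => [->|_ ak]; last by rewrite mul1r -(subr0 (a _)).
    move=> ad; rewrite -(subrK (residue_frac R m j true) (a d)) mulrDr.
    by rewrite residue_frac_mul; apply: rpredD; [apply: rpredM|]; rewrite ?natr_int.
  have -> : \sum_i c i = \sum_i (c i - Sfrac R m d j i) + \sum_i Sfrac R m d j i.
    by rewrite sumrB subrK.
  by rewrite sum_Sfrac // rpredD ?natr_int // rpred_sum.
Qed.

(** * The Ehrhart series of the join of T and S *)

Lemma sum_expX_pos (l s : nat) :
  \sum_(j < l.+1) 'X^(s * (0 < j)) = 1 + l%:Z *: 'X^s :> {poly int}.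
Proof.
rewrite big_ord_recl muln0 expr0; congr (_ + _).
under eq_bigr do rewrite /= muln1.
by rewrite sumr_const card_ord -scaler_nat natz.
Qed.

Theorem mainTheorem3 (R : realType) (p q l m : nat)
    (p_gt0 : (0 < p)%N) (q_gt0 : (0 < q)%N)
    (l_gt0 : (0 < l)%N) (m_gt0 : (0 < m)%N) (q_odd : odd q) :
  let P : set 'rV[R]_(q + p + 1) :=
    polytope_join (Tsimplex R (l + 1) q) (Ssimplex R (m + 1) p) in
  series_eq_frac (Ehr P)
    (1 + m%:Z *: 'X + l%:Z *: 'X^((q + 1) %/ 2)
       + (m * l)%:Z *: 'X^((q + 3) %/ 2))
    ((1 - 'X) ^+ (p + q + 2))
  /\ ((3 <= q)%N -> (l < m)%N ->
      [/\ lattice_polytope P,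
          no_interior_lattice_point P &
          exists i : nat, (1 <= i <= ehrhart_deg P - 1)%N
            /\ ehrhart_coef P i < ehrhart_coef P 1]).
Proof.
move=> P; set s := ((q + 1) %/ 2)%N.
have sE : q.+1./2 = s by rewrite /s addn1 divn2.
have -> : ((q + 3) %/ 2)%N = s.+1 by rewrite /s; lia.
set N := (_ + _ : {poly int}).
have succ_gt0 n : (0 < n + 1)%N by rewrite addn1.
have B := box_decomposition_join
  (@Tsimplex_box R (l + 1) q (succ_gt0 l) q_odd)
  (@Ssimplex_box R (m + 1) p (succ_gt0 m) p_gt0).
have cI : #|{: 'I_q.+1 + 'I_p.+1}| = (q + p + 1).+1.
  by rewrite card_sum !card_ord; lia.
have PE : P = convex_hull (range (join_vertex (Tvertex R (l + 1) q)
    (Svertex R (m + 1) p))).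
  by rewrite /P TsimplexE // SsimplexE // polytope_join_hull.
have NE : \sum_(j : 'I_(l + 1) * 'I_(m + 1))
    'X^(q.+1./2 * (0 < j.1) + (0 < j.2)) = N.
  rewrite sE; under eq_bigr do rewrite exprD.
  rewrite -(pair_bigA _ (fun (i : 'I_(l + 1)) (j : 'I_(m + 1)) =>
    'X^(s * (0 < i)) * 'X^(0 < j) : {poly int})) /= -big_distrlr /=.
  have sum1 : \sum_(j < m.+1) 'X^(0 < j) = 1 + m%:Z *: 'X :> {poly int}.
    rewrite -['X in RHS]expr1 -sum_expX_pos.
    by apply: eq_bigr => j _; rewrite mul1n.
  rewrite !addn1 sum_expX_pos sum1 /N exprS PoszM -!mul_polyC rmorphM /=.
  by ring.
have EhrP : series_eq_frac (Ehr P) N ((1 - 'X) ^+ (q + p + 1).+1).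
  by rewrite PE -NE -cI; apply: Ehr_box B _; rewrite cI.
split; first by have -> : (p + q + 2 = (q + p + 1).+1)%N by lia.
move=> q3 lm.
have s2 : (1 < s)%N by rewrite /s; lia.
have coefN n : N`_n = (n == 0%N)%:Z + m%:Z * (n == 1%N)%:Z +
    l%:Z * (n == s)%:Z + (m * l)%:Z * (n == s.+1)%:Z.
  by rewrite !coefD !coefZ coef1 coefX !coefXn !natz.
have sizeN : size N = s.+2.
  apply/eqP; rewrite eqn_leq; apply/andP; split.
    apply/leq_sizeP => n ns; rewrite coefN !gtn_eqF ?mulr0 ?addr0 //; lia.
  rewrite ltnNge; apply/negP => /leq_sizeP/(_ s.+1 (leqnn _)).
  rewrite coefN eqxx !gtn_eqF //; nia.
have numE : ehrhart_numerator P = N.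
  by apply: ehrhart_numerator_eq => //; rewrite sizeN /s; lia.
split.
- by rewrite PE; apply: lattice_polytope_box B cI.
- exact: join_no_interior_lattice_point.
exists s; rewrite /ehrhart_deg /ehrhart_coef numE sizeN !coefN.
split; first by lia.
lia.
Qed.
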